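(* Let $n\ge1$ and $D=2n$. Fix $m\geq0$, put $M=\lfloor m/2\rfloor$, and choose any $v_k\in\mathscr Y_{m-2k}(\mathbb R^D)$, $0\leq k\leq M$. Set $u_{M+1}=u_{M+2}=0$ and $u_M=v_M$. Recursively, for $k=M-1,M-2,\ldots,0$, define $$b_k=-4(k+1)\mathcal Ru_{k+1}-4(k+2)(k+1)r^2u_{k+2},\qquad u_k=v_k+\mathcal G_{m-2k-2}b_k.$$ Then $$h(z,t)=\sum_{k=0}^{M}t^ku_k(z)\in H_m(\mathbb H^n).$$ Moreover, every element of $H_m(\mathbb H^n)$ is obtained in exactly one way. Consequently, the construction $(v_k)_{0\le k\le M}\mapsto h$ is a linear isomorphism $$\bigoplus_{k=0}^{\lfloor m/2\rfloor}\mathscr Y_{m-2k}(\mathbb R^{2n})\simeq H_m(\mathbb H^n).$$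
   Context: $\mathbb H^n=\mathbb C^n\times\mathbb R$, $z_j=x_j+iy_j$, with horizontal fields $X_j=\partial_{x_j}+2y_j\partial_t$, $Y_j=\partial_{y_j}-2x_j\partial_t$ and sub-Laplacian $\Delta_H=\sum_{j=1}^n(X_j^2+Y_j^2)$. $P_m(\mathbb H^n)$ is the space of complex polynomials in $(x,y,t)$ of weighted homogeneous degree $m$ (horizontal variables $x_j,y_j$ have weight one, $t$ has weight two; $\{0\}$ for negative $m$), and $H_m(\mathbb H^n)=\ker(\Delta_H:P_m(\mathbb H^n)\to P_{m-2}(\mathbb H^n))$. $D=2n$, $r^2=|z|^2=\sum_j(x_j^2+y_j^2)$, $\mathcal R=\sum_{j=1}^n(y_j\partial_{x_j}-x_j\partial_{y_j})$, $\Delta_z=\sum_{j=1}^n(\partial_{x_j}^2+\partial_{y_j}^2)$. $\mathscr P_d(\mathbb R^D)$ denotes the complex homogeneous polynomials of ordinary degree $d$ in the horizontal variables ($\{0\}$ for $d<0$), and $\mathscr Y_d(\mathbb R^D)=\ker(\Delta_z:\mathscr P_d(\mathbb R^D)\to\mathscr P_{d-2}(\mathbb R^D))$. For $d\ge0$, $\mathcal G_d:\mathscr P_d(\mathbb R^D)\to\mathscr P_{d+2}(\mathbb R^D)$ is the linear map $$\mathcal G_dq=\sum_{j=0}^{\lfloor d/2\rfloor}\frac{(-1)^jr^{2j+2}\Delta_z^jq}{\prod_{\ell=0}^{j}2(\ell+1)(2d+D-2\ell)}.$$ *)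

(* Defs.v *)
From HB Require Import structures.
From mathcomp Require Import all_boot all_order all_algebra.
From mathcomp Require Export complex.
From mathcomp Require Export reals.
From mathcomp.multinomials Require Export mpoly.

Set Implicit Arguments.
Unset Strict Implicit.
Unset Printing Implicit Defensive.

Import GRing.Theory.
Local Open Scope ring_scope.

(* A finite direct sum of left modules, as the module of dependent families
   with pointwise operations. *)
Section DirectSum.
Variables (K : pzRingType) (I : finType) (V : I -> lmodType K).
Local Notation DS := {dffun forall i : I, V i}.
Implicit Types f g : DS.

Definition ds_zero : DS := [ffun i => 0 : V i].
Definition ds_opp f : DS := [ffun i => - f i : V i].
Definition ds_add f g : DS := [ffun i => f i + g i : V i].
Definition ds_scale (a : K) f : DS := [ffun i => a *: f i : V i].

Fact ds_addA : associative ds_add.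
Proof. by move=> f g h; apply/ffunP => i; rewrite !ffunE addrA. Qed.
Fact ds_addC : commutative ds_add.
Proof. by move=> f g; apply/ffunP => i; rewrite !ffunE addrC. Qed.
Fact ds_add0 : left_id ds_zero ds_add.
Proof. by move=> f; apply/ffunP => i; rewrite !ffunE add0r. Qed.
Fact ds_addN : left_inverse ds_zero ds_opp ds_add.
Proof. by move=> f; apply/ffunP => i; rewrite !ffunE addNr. Qed.

HB.instance Definition _ :=
  GRing.isZmodule.Build DS ds_addA ds_addC ds_add0 ds_addN.

Fact ds_scaleA a b f : ds_scale a (ds_scale b f) = ds_scale (a * b) f.
Proof. by apply/ffunP => i; rewrite !ffunE scalerA. Qed.
Fact ds_scale1 : left_id 1 ds_scale.
Proof. by move=> f; apply/ffunP => i; rewrite !ffunE scale1r. Qed.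
Fact ds_scaleDr : right_distributive ds_scale +%R.
Proof. by move=> a f g; apply/ffunP => i; rewrite !ffunE scalerDr. Qed.
Fact ds_scaleDl f : {morph ds_scale^~ f : a b / a + b}.
Proof. by move=> a b; apply/ffunP => i; rewrite !ffunE scalerDl. Qed.

HB.instance Definition _ :=
  GRing.Zmodule_isLmodule.Build K DS ds_scaleA ds_scale1 ds_scaleDr ds_scaleDl.
End DirectSum.

(* The horizontal variables are indexed by 'I_(n + n): lshift n j is x_j and
   rshift n j is y_j.  On the Heisenberg group the variables are indexed by
   'I_(n + n).+1; the first n + n are the horizontal ones (so that mwiden
   embeds the polynomials in z), and ord_max is t. *)
Section Operators.
Variables (C : fieldType) (n : nat).
Local Notation PZ := {mpoly C[n + n]}.
Local Notation PH := {mpoly C[(n + n).+1]}.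

Definition zx (j : 'I_n) : 'I_(n + n) := lshift n j.
Definition zy (j : 'I_n) : 'I_(n + n) := rshift n j.
Definition hx (j : 'I_n) : 'I_(n + n).+1 := widen_ord (leqnSn _) (zx j).
Definition hy (j : 'I_n) : 'I_(n + n).+1 := widen_ord (leqnSn _) (zy j).
Definition ht : 'I_(n + n).+1 := ord_max.

Definition fieldX (j : 'I_n) (p : PH) : PH :=
  p^`M(hx j) + 2%:R *: ('X_(hy j) * p^`M(ht)).
Definition fieldY (j : 'I_n) (p : PH) : PH :=
  p^`M(hy j) - 2%:R *: ('X_(hx j) * p^`M(ht)).
Definition subLaplacian (p : PH) : PH :=
  \sum_(j < n) (fieldX j (fieldX j p) + fieldY j (fieldY j p)).

Definition weight (m : 'X_{1..(n + n).+1}) : nat :=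
  (\sum_(i < (n + n).+1) (if i == ht then 2 else 1) * m i)%N.

Fact weight0 : weight 0%MM = 0.
Proof. by rewrite /weight big1 // => i _; rewrite mnm0E muln0. Qed.
Fact weightD : {morph weight : m1 m2 / (m1 + m2)%MM >-> (m1 + m2)%N}.
Proof.
by move=> a b; rewrite /weight -big_split; apply: eq_bigr => i _;
  rewrite mnmDE mulnDr.
Qed.
HB.instance Definition _ := isMeasure.Build (n + n).+1 weight weight0 weightD.

Definition r2 : PZ := \sum_(j < n) ('X_(zx j) ^+ 2 + 'X_(zy j) ^+ 2).
Definition rotation (q : PZ) : PZ :=
  \sum_(j < n) ('X_(zy j) * q^`M(zx j) - 'X_(zx j) * q^`M(zy j)).
Definition Laplacian (q : PZ) : PZ :=
  \sum_(j < n) (q^`M(zx j)^`M(zx j) + q^`M(zy j)^`M(zy j)).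

Fact fieldX_is_linear j : linear (fieldX j).
Proof.
move=> a p q; rewrite /fieldX !linearP /= mulrDr scalerDr -scalerAr scalerA.
by rewrite [2%:R * a]mulrC -scalerA addrACA -scalerDr.
Qed.
Fact fieldY_is_linear j : linear (fieldY j).
Proof.
move=> a p q; rewrite /fieldY !linearP /= mulrDr scalerDr -scalerAr scalerA.
by rewrite [2%:R * a]mulrC -scalerA opprD addrACA -scalerBr.
Qed.
Fact subLaplacian_is_linear : linear subLaplacian.
Proof.
move=> a p q; rewrite /subLaplacian scaler_sumr -big_split.
apply: eq_bigr => j _ /=.
by rewrite !fieldX_is_linear !fieldY_is_linear addrACA -scalerDr.
Qed.
Fact Laplacian_is_linear : linear Laplacian.
Proof.
move=> a p q; rewrite /Laplacian scaler_sumr -big_split.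
by apply: eq_bigr => j _ /=; rewrite !linearP addrACA -scalerDr.
Qed.
HB.instance Definition _ :=
  GRing.isLinear.Build C PH PH _ subLaplacian subLaplacian_is_linear.
HB.instance Definition _ :=
  GRing.isLinear.Build C PZ PZ _ Laplacian Laplacian_is_linear.

(* A Laplacian of a polynomial of degree < 2 vanishes, so the convention that
   the spaces of negative degree are {0} needs no separate case. *)
Definition Ypred (d : nat) : pred PZ :=
  fun q => (q \is d.-homog) && (Laplacian q == 0).
Definition Hpred (m : nat) : pred PH :=
  fun p => (p \is m.-homog for weight) && (subLaplacian p == 0).

Fact Ypred_submod d : submod_closed (Ypred d).
Proof.
split=> [|a p q]; first by apply/andP; rewrite dhomog0 linear0 eqxx.
move=> /andP[hp /eqP p0] /andP[hq /eqP q0]; apply/andP; split.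
  by apply: rpredD => //; apply: rpredZ.
by rewrite Laplacian_is_linear p0 q0 scaler0 addr0 eqxx.
Qed.
Fact Hpred_submod m : submod_closed (Hpred m).
Proof.
split=> [|a p q]; first by apply/andP; rewrite dhomog0 linear0 eqxx.
move=> /andP[hp /eqP p0] /andP[hq /eqP q0]; apply/andP; split.
  by apply: rpredD => //; apply: rpredZ.
by rewrite subLaplacian_is_linear p0 q0 scaler0 addr0 eqxx.
Qed.
HB.instance Definition _ d :=
  GRing.isSubmodClosed.Build C PZ (Ypred d) (Ypred_submod d).
HB.instance Definition _ m :=
  GRing.isSubmodClosed.Build C PH (Hpred m) (Hpred_submod m).

Record Yspace (d : nat) := MkY { Yval :> PZ; _ : Yval \in Ypred d }.
HB.instance Definition _ d := [isSub for @Yval d].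
HB.instance Definition _ d := [Choice of Yspace d by <:].
HB.instance Definition _ d := [SubChoice_isSubLmodule of Yspace d by <:].

Record Hspace (m : nat) := MkH { Hval :> PH; _ : Hval \in Hpred m }.
HB.instance Definition _ m := [isSub for @Hval m].
HB.instance Definition _ m := [Choice of Hspace m by <:].
HB.instance Definition _ m := [SubChoice_isSubLmodule of Hspace m by <:].

(* The subtraction is the one of C, not the truncated one of nat. *)
Definition Gop (d : nat) (q : PZ) : PZ :=
  \sum_(j < d./2.+1)
    ((-1) ^+ j / \prod_(l < j.+1)
       (2%:R * l.+1%:R * (2%:R * d%:R + (2 * n)%N%:R - 2%:R * l%:R)))
    *: (r2 ^+ j.+1 * iter j Laplacian q).

Definition bterm (k : nat) (u1 u2 : PZ) : PZ :=
  - (4%:R * k.+1%:R) *: rotation u1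
  - (4%:R * k.+2%:R * k.+1%:R) *: (r2 * u2).

(* uaux m v i = (u_(M - i), u_(M - i + 1)) with M = m./2. *)
Fixpoint uaux (m : nat) (v : nat -> PZ) (i : nat) : PZ * PZ :=
  if i is i'.+1 then
    let: (u1, u2) := uaux m v i' in
    let k := (m./2 - i)%N in
    (v k + Gop (m - 2 * k - 2)%N (bterm k u1 u2), u1)
  else (v m./2, 0).

Definition useq (m : nat) (v : nat -> PZ) (k : nat) : PZ :=
  if (k <= m./2)%N then (uaux m v (m./2 - k)).1 else 0.

Lemma useq_gt m v k : (m./2 < k)%N -> useq m v k = 0.
Proof. by rewrite /useq ltnNge => /negbTE ->. Qed.
Lemma useq_top m v : useq m v m./2 = v m./2.
Proof. by rewrite /useq leqnn subnn. Qed.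
Lemma useq_rec m v k : (k < m./2)%N ->
  useq m v k =
    v k + Gop (m - 2 * k - 2)%N (bterm k (useq m v k.+1) (useq m v k.+2)).
Proof.
move=> lt_kM; rewrite /useq (ltnW lt_kM) lt_kM.
have uaux2 i : (uaux m v i.+1).2 = (uaux m v i).1 by rewrite /=; case: uaux.
have -> : (m./2 - k = (m./2 - k.+1).+1)%N by rewrite subnSK.
have kE : (m./2 - (m./2 - k.+1).+1 = k)%N by rewrite subnSK // subKn // ltnW.
rewrite [uaux m v (_).+1]/= kE.
case Eu: (uaux m v (m./2 - k.+1)) => [u1 u2] /=.
suff -> : u2 = if (k.+1 < m./2)%N then (uaux m v (m./2 - k.+2)).1 else 0 by [].
case: ltnP => [lt2|le2].
  by rewrite -uaux2 subnSK // Eu.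
by move: Eu; rewrite (eqP (le2 : (m./2 <= k.+1)%N)) /= => -[].
Qed.

(* For k <= m./2 the subtraction m - 2 * k is exact and (inord k : 'I_m./2.+1)
   is k; for k < m./2 so is m - 2 * k - 2. *)
Definition Ysum (m : nat) : lmodType C :=
  {dffun forall k : 'I_m./2.+1, Yspace (m - 2 * k)%N}.

Definition hpoly (m : nat) (v : Ysum m) : PH :=
  \sum_(k < m./2.+1)
    'X_ht ^+ k * mwiden (useq m (fun i => v (inord i) : PZ) k).

End Operators.

(* Main.v *)
From HB Require Import structures.
Require Import Defs.
From mathcomp Require Import all_boot all_order all_algebra.
From mathcomp Require Import ring zify.

Set Implicit Arguments.
Unset Strict Implicit.
Unset Printing Implicit Defensive.

Import GRing.Theory.
Local Open Scope ring_scope.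

(** Write a polynomial on the Heisenberg group as a sum of t^k u_k(z).  Since
X_j^2 + Y_j^2 = d_x^2 + d_y^2 + 4 (y d_x - x d_y) d_t + 4 (x^2 + y^2) d_t^2,
the coefficient of t^k in its sub-Laplacian is Delta_z u_k - b_k, where b_k
depends only on u_(k+1) and u_(k+2) ([subLaplacian_tsum]).  A polynomial of
weight m therefore lies in the kernel exactly when each u_k is homogeneous of
degree m - 2 k and Delta_z u_k = b_k for all k ([tsum_in_Hpred] and
[Hpred_tsum]).

Such a triangular system is solved downward from k = m./2 once Delta_z has a
right inverse on homogeneous polynomials, and G_d is one ([Laplacian_GopK]).
Indeed Euler's identity gives, for p homogeneous of degree e,
Delta_z (r^(2 j + 2) p) = 2 (j + 1) (2 e + 2 j + D) r^(2 j) p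
+ r^(2 j + 2) Delta_z p ([Laplacian_r2XM]).  For p = Delta_z^j q, where
e = d - 2 j, the scalar is the j-th factor of the denominators of G_d, so that
Delta_z (G_d q) telescopes to q.

The solutions u_k of Delta_z u_k = b_k are thus G b_k plus an arbitrary
harmonic polynomial v_k.  Hence v |-> h takes values in the kernel, and its
inverse sends h to the residuals v_k = u_k - G b_k, which h determines because
it determines the u_k. *)

(** * Partial derivatives and homogeneity *)

Section Derivatives.
Variables (C : fieldType) (N : nat).
Implicit Types p q : {mpoly C[N]}.

Lemma mderivXU i j : ('X_j : {mpoly C[N]})^`M(i) = (i == j)%:R.
Proof.
rewrite mderivX mnm1E eq_sym; case: eqP => [->|_]; last by rewrite scale0r.
by rewrite scale1r (_ : (_ - _)%MM = 0%MM) ?mpolyX0 //; apply/mnmP=> k;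
  rewrite mnmBE subnn mnm0E.
Qed.

Lemma mderivXUn i j k : ('X_j ^+ k : {mpoly C[N]})^`M(i) =
  (i == j)%:R * (k%:R * 'X_j ^+ k.-1).
Proof.
elim: k => [|k IHk]; first by rewrite expr0 mul0r mulr0 -mpolyC1 mderivC.
rewrite exprS mderivM mderivXU IHk /=.
by case: k {IHk} => [|k] /=; rewrite ?expr0 ?exprS; ring.
Qed.

Lemma mpolyXU_mderiv i m :
  'X_i * 'X_[m]^`M(i) = (m i)%:R *: 'X_[m] :> {mpoly C[N]}.
Proof.
rewrite mderivX -scalerAr -mpolyXD.
case: (posnP (m i)) => [->|mi]; first by rewrite !scale0r.
by rewrite addmC submK // lep1mP -lt0n.
Qed.

(** Euler's identity: each monomial is an eigenvector of every x_i d_i, and the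
eigenvalues add up to its degree. *)
Lemma euler_dhomog d q :
  q \is d.-homog -> \sum_i 'X_i * q^`M(i) = d%:R *: q.
Proof.
move=> hq; rewrite [in LHS](mpolyE q) [in RHS](mpolyE q) scaler_sumr.
under eq_bigr do rewrite linear_sum mulr_sumr.
rewrite exchange_big /= !big_seq; apply: eq_bigr => m mq.
under eq_bigr do rewrite linearZ /= -scalerAr mpolyXU_mderiv.
rewrite -scaler_sumr -scaler_suml -natr_sum -mdegE.
by rewrite (dhomog_mf hq mq) !scalerA mulrC.
Qed.

Lemma dhomogXU i : ('X_i : {mpoly C[N]}) \is 1.-homog.
Proof. by rewrite dhomogX /= mdeg1. Qed.

Lemma mderiv_supp i q d m :
  q \is d.-homog -> m \in msupp (q^`M(i)) -> (mdeg m).+1 = d.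
Proof.
move=> hq; rewrite mcoeff_msupp mcoeff_mderiv => nz.
have mq : (m + U_(i))%MM \in msupp q.
  by rewrite mcoeff_msupp; apply: contraNneq nz => ->; rewrite mul0rn.
by rewrite -(dhomog_mf hq mq) /= mdegD mdeg1 addn1.
Qed.

Lemma dhomog_mderiv i d q : q \is d.-homog -> q^`M(i) \is d.-1.-homog.
Proof. by move=> hq; apply/dhomogP => m /(mderiv_supp hq) <-. Qed.

Lemma mderiv_homog0 i q : q \is 0.-homog -> q^`M(i) = 0.
Proof.
move=> hq; apply/eqP; rewrite -msupp_eq0; case E: msupp => [//|m s].
by have := mderiv_supp (i := i) (m := m) hq; rewrite E mem_head => /(_ isT).
Qed.

(** In degree 0 the derivative vanishes, so the truncation in [d.-1] is
harmless. *)
Lemma dhomog_XU_mderiv i j d q : q \is d.-homog -> 'X_i * q^`M(j) \is d.-homog.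
Proof.
case: d => [|d] hq; first by rewrite mderiv_homog0 ?mulr0 ?dhomog0.
rewrite -add1n; apply: dhomogM; first exact: dhomogXU.
exact: (dhomog_mderiv j hq).
Qed.

End Derivatives.

(** * The horizontal Laplacian and its right inverse *)

Section Horizontal.
Variables (C : fieldType) (n : nat).
Local Notation PZ := {mpoly C[n + n]}.
Implicit Types p q : PZ.
Local Notation r2 := (r2 C n).

(** Both r^2 and the Laplacian treat the x_j and the y_j alike, so they become
sums over all 2 n variables. *)
Lemma r2_sum : r2 = \sum_i 'X_i ^+ 2.
Proof. by rewrite /r2 big_split big_split_ord. Qed.

Lemma Laplacian_sum q : Laplacian q = \sum_i q^`M(i)^`M(i).
Proof. by rewrite /Laplacian big_split big_split_ord. Qed.

Lemma mderiv_r2 i : r2^`M(i) = 'X_i *+ 2.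
Proof.
rewrite r2_sum linear_sum (bigD1 i) //= mderivXUn eqxx.
rewrite big1 => [|j /negPf ji]; first by rewrite mul1r addr0 expr1 mulr_natl.
by rewrite mderivXUn [i == j]eq_sym ji mul0r.
Qed.

(** Leibniz: the mixed term is 2 grad r^2 . grad p = 4 sum_i x_i d_i p, which
Euler's identity evaluates. *)
Lemma Laplacian_r2M d p : p \is d.-homog ->
  Laplacian (r2 * p) =
    ((n + n)%:R * 2%:R + 4%:R * d%:R) *: p + r2 * Laplacian p.
Proof.
move=> hp; rewrite !Laplacian_sum mulr_sumr.
have -> : ((n + n)%:R * 2%:R + 4%:R * d%:R) *: p =
  \sum_(i < n + n) (2%:R * p + 4%:R * ('X_i * p^`M(i))).
  rewrite big_split /= -!mulr_sumr (euler_dhomog hp).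
  rewrite sumr_const card_ord -!natrM -natrD !scaler_nat !mulr_natl.
  by rewrite -!mulrnA -mulrnDr [(d * 4)%N]mulnC.
rewrite -big_split; apply: eq_bigr => i _ /=.
rewrite mderivM linearD /= mderiv_r2 !mderivM mderiv_r2 mderivMn mderivXU eqxx.
rewrite mulr1n; ring.
Qed.

Lemma dhomog_r2 : r2 \is 2.-homog.
Proof.
rewrite r2_sum; apply: rpred_sum => i _.
by rewrite -[2%N]mul1n; apply/dhomogMn/dhomogXU.
Qed.

Lemma dhomog_Laplacian d q : q \is d.-homog -> Laplacian q \is (d - 2).-homog.
Proof.
move=> hq; rewrite Laplacian_sum; apply: rpred_sum => i _.
by rewrite subn2; do 2!apply: dhomog_mderiv.
Qed.

Lemma Laplacian_lowdeg d q : q \is d.-homog -> (d < 2)%N -> Laplacian q = 0.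
Proof.
move=> hq d2; rewrite Laplacian_sum big1 // => i _.
by apply: mderiv_homog0; have := dhomog_mderiv i hq; case: d d2 {hq} => [|[]].
Qed.

Lemma dhomog_rotation d q : q \is d.-homog -> rotation q \is d.-homog.
Proof.
by move=> hq; apply: rpred_sum => j _; apply: rpredB; apply: dhomog_XU_mderiv.
Qed.

Lemma rotation_is_linear : linear (@rotation C n).
Proof.
move=> a p q; rewrite /rotation scaler_sumr -big_split; apply: eq_bigr => j _.
rewrite /= !linearP /= !mulrDr -!scalerAr opprD addrACA.
by rewrite scalerBr.
Qed.
HB.instance Definition _ :=
  GRing.isLinear.Build C PZ PZ _ (@rotation C n) rotation_is_linear.

Lemma dhomog_iter_Laplacian d j q :
  q \is d.-homog -> iter j (@Laplacian C n) q \is (d - 2 * j).-homog.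
Proof.
move=> hq; elim: j => [|j IHj]; first by rewrite muln0 subn0.
by rewrite mulnSr subnDA; apply: dhomog_Laplacian.
Qed.

(** This kills the last term of the telescoping sum in [Laplacian_GopK]. *)
Lemma iter_Laplacian_eq0 d j q :
  q \is d.-homog -> (d < 2 * j)%N -> iter j (@Laplacian C n) q = 0.
Proof.
elim: j => [|j IHj] hq dj; first by lia.
rewrite iterS; case: (ltnP d (2 * j)) => [lt|ge]; first by rewrite IHj ?linear0.
by apply: Laplacian_lowdeg (dhomog_iter_Laplacian j hq) _; lia.
Qed.

(** Induction on [j], with [Laplacian_r2M] applied to r^(2 j) p, of degree
d + 2 j.  The scalar is arranged as in the denominators of [Gop]. *)
Lemma Laplacian_r2XM d j p : p \is d.-homog ->
  Laplacian (r2 ^+ j.+1 * p) =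
    (2%:R * j.+1%:R * (2%:R * (d + j.*2)%:R + (2 * n)%N%:R - 2%:R * j%:R))
      *: (r2 ^+ j * p) + r2 ^+ j.+1 * Laplacian p.
Proof.
move=> hp; elim: j => [|j IHj].
  rewrite expr1 expr0 mul1r (Laplacian_r2M hp) //; congr (_ *: _ + _).
  by rewrite addn0 natrD natrM; ring.
have hrp : r2 ^+ j.+1 * p \is (j.+1.*2 + d).-homog.
  by rewrite -mul2n; apply: dhomogM hp; apply/dhomogMn/dhomog_r2.
rewrite exprS -mulrA (Laplacian_r2M hrp) IHj [r2 * (_ + _)]mulrDr -scalerAr.
rewrite [r2 * (_ * p)]mulrA -exprS addrA -scalerDl mulrA -exprS.
congr (_ *: _ + _).
by rewrite -!muln2; ring.
Qed.

Lemma dhomog_Gop d q : q \is d.-homog -> Gop d q \is d.+2.-homog.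
Proof.
move=> hq; apply: rpred_sum => j _; apply: rpredZ.
have -> : d.+2 = (2 * j.+1 + (d - 2 * j))%N.
  by have := ltn_ord j; lia.
by apply: dhomogM (dhomog_iter_Laplacian _ hq); apply/dhomogMn/dhomog_r2.
Qed.

Lemma Gop_is_linear d : linear (@Gop C n d).
Proof.
have iterL j : linear (iter j (@Laplacian C n)).
  by elim: j => [|j IHj] a p q //; rewrite !iterS IHj linearP.
move=> a p q; rewrite /Gop scaler_sumr -big_split; apply: eq_bigr => j _ /=.
by rewrite iterL mulrDr scalerDr -scalerAr !scalerA [a * _]mulrC.
Qed.
HB.instance Definition _ d :=
  GRing.isLinear.Build C PZ PZ _ (Gop d) (Gop_is_linear d).

(** Applying the Laplacian to the j-th summand of G_d q yields T_j - T_(j+1),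
where T_j is a multiple of r^(2 j) Delta^j q, T_0 = q, and T_j = 0 as soon as
2 j > d. *)
Lemma Laplacian_GopK d q : [pchar C] =i pred0 -> (0 < n)%N ->
  q \is d.-homog -> Laplacian (Gop d q) = q.
Proof.
move=> /pcharf0P charC n_gt0 hq.
pose a l : C := 2%:R * l.+1%:R * (2%:R * d%:R + (2 * n)%N%:R - 2%:R * l%:R).
(* For l <= d / 2 the last factor is at least 2 n > 0. *)
have a_neq0 l : (l <= d./2)%N -> a l != 0.
  move=> ld; suff -> : a l = (2 * l.+1 * (2 * d + 2 * n - 2 * l))%N%:R.
    by rewrite charC !muln_eq0; lia.
  by rewrite natrM natrB /a; [ring | lia].
pose T j :=
  ((-1) ^+ j / \prod_(l < j) a l) *: (r2 ^+ j * iter j (@Laplacian C n) q).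
have step j : (j <= d./2)%N ->
  Laplacian (((-1) ^+ j / \prod_(l < j.+1) a l)
      *: (r2 ^+ j.+1 * iter j (@Laplacian C n) q)) = - (T j.+1 - T j).
  move=> jd; rewrite linearZ /= (Laplacian_r2XM _ (dhomog_iter_Laplacian j hq)).
  have -> : (d - 2 * j + j.*2)%N = d by lia.
  rewrite -/(a j) scalerDr scalerA opprB; congr (_ *: _ + _).
    by rewrite big_ord_recr /= invfM -!mulrA mulVf ?a_neq0 // mulr1.
  by rewrite -scaleNr [(-1) ^+ j.+1]exprS mulN1r mulNr opprK.
rewrite /Gop linear_sum.
rewrite (eq_bigr (fun j : 'I_d./2.+1 => - (T j.+1 - T j))); last first.
  by move=> j _; apply: step; rewrite -ltnS.
rewrite sumrN -(big_mkord xpredT (fun j => T j.+1 - T j)) telescope_sumr //.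
rewrite /T (iter_Laplacian_eq0 hq); last by lia.
by rewrite big_ord0 expr0 divr1 scale1r expr0 mul1r mulr0 scaler0 sub0r opprK.
Qed.

End Horizontal.

(** * Expansion in powers of the last variable *)

Section Widening.
Variables (C : fieldType) (N : nat).
Implicit Types q : {mpoly C[N]}.
Local Notation widen := (widen_ord (leqnSn N)).

Lemma mwidenXU i : mwiden ('X_i : {mpoly C[N]}) = 'X_(widen i).
Proof. by rewrite mwidenX mnmwiden1. Qed.

Lemma mderiv_mwiden i q : (mwiden q)^`M(widen i) = mwiden q^`M(i).
Proof.
elim/mpolyind: q => [|c m q _ _ IHq]; first by rewrite !raddf0.
rewrite !(mwidenD, mderivD) IHq; congr (_ + _).
rewrite !(mwidenZ, mderivZ, mwidenX, mderivX) mnmwiden_widen.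
case: (posnP (m i)) => [->|mi]; first by rewrite !scale0r.
do 2!congr (_ *: _); congr 'X_[_].
rewrite -{1}[m](@submK _ U_(i)%MM) ?lep1mP -?lt0n //.
by rewrite mnmwidenD mnmwiden1 addmK.
Qed.

Lemma mderiv_mwiden_max q : (mwiden q)^`M(ord_max) = 0.
Proof.
elim/mpolyind: q => [|c m q _ _ IHq]; first by rewrite !raddf0.
rewrite mwidenD mderivD IHq addr0 mwidenZ mderivZ mwidenX mderivX.
by rewrite mnmwiden_ordmax scale0r scaler0.
Qed.

Definition mnmtrunc (m : 'X_{1..N.+1}) : 'X_{1..N} :=
  [multinom m (widen i) | i < N].

Lemma mpolyX_split (m : 'X_{1..N.+1}) :
  'X_ord_max ^+ (m ord_max) * mwiden 'X_[mnmtrunc m] = 'X_[m]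
    :> {mpoly C[N.+1]}.
Proof.
rewrite [RHS]mpolyXE_id big_ord_recr /= mulrC [in LHS]mpolyXE_id rmorph_prod.
congr (_ * _); apply: eq_bigr => i _.
by rewrite rmorphXn /= mwidenXU mnmE.
Qed.

Lemma muni_mwiden q : muni (mwiden q) = q%:P.
Proof.
elim/mpolyind: q => [|c m q _ _ IHq]; first by rewrite !raddf0.
rewrite mwidenD muniD IHq polyCD; congr (_ + _).
rewrite mwidenZ mwidenX muniZ muniE msuppX big_seq1.
rewrite mcoeffX eqxx scale1r mnmwiden_ordmax expr0 alg_polyC -mul_polyC.
rewrite -polyCM mul_mpolyC; congr (_ *: 'X_[_])%:P.
by apply/mnmP => i; rewrite mnmE mnmwiden_widen.
Qed.

Lemma muniX_max : muni ('X_ord_max : {mpoly C[N.+1]}) = 'X.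
Proof.
rewrite muniE msuppX big_seq1 mcoeffX eqxx scale1r mnm1E eqxx expr1.
rewrite (_ : [multinom _ | i < N] = 0%MM) ?mpolyX0 ?scale1r //.
by apply/mnmP => i; rewrite mnmE mnm1E mnm0E -val_eqE /= gtn_eqF.
Qed.

(** The polynomial of degree less than [K] in the last variable whose
coefficients, polynomials in the others, are the u_k. *)
Definition tsum K (u : nat -> {mpoly C[N]}) : {mpoly C[N.+1]} :=
  \sum_(k < K) 'X_ord_max ^+ k * mwiden (u k).

Lemma muni_tsum K u : muni (tsum K u) = \poly_(k < K) u k.
Proof.
rewrite poly_def rmorph_sum; apply: eq_bigr => k _.
by rewrite rmorphM rmorphXn /= muniX_max muni_mwiden mulrC mul_polyC.
Qed.

(** [muni] turns [tsum] into a univariate polynomial, whose coefficients can be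
read off. *)
Lemma tsum_inj K u v :
  tsum K u = tsum K v -> forall k, (k < K)%N -> u k = v k.
Proof.
move=> uv k kK; have /polyP/(_ k) := congr1 (@muni N C) uv.
by rewrite !muni_tsum !coef_poly kK.
Qed.

Lemma coef_muni (p : {mpoly C[N.+1]}) k : (muni p)`_k =
  \sum_(m <- msupp p | m ord_max == k) p@_m *: 'X_[mnmtrunc m].
Proof.
rewrite muniE coef_sum [RHS]big_mkcond; apply: eq_bigr => m _.
by rewrite coefZ coefXn eq_sym; case: eqP => _; rewrite ?mulr1 ?mulr0.
Qed.

Lemma tsum_muni K (p : {mpoly C[N.+1]}) :
  {in msupp p, forall m : 'X_{1..N.+1}, (m ord_max < K)%N} ->
  tsum K (fun k => (muni p)`_k) = p.
Proof.
move=> pK; rewrite /tsum [RHS]mpolyE.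
under eq_bigr do rewrite coef_muni raddf_sum mulr_sumr big_mkcond.
rewrite exchange_big /= !big_seq; apply: eq_bigr => m /pK mK.
rewrite -big_mkcond /= (big_pred1 (Ordinal mK)) => [|i]; last first.
  by rewrite /= -val_eqE eq_sym.
by rewrite mwidenZ -scalerAr mpolyX_split.
Qed.

End Widening.

(** Realigns the terms t^(k-1) and t^(k-2) produced by d_t. *)
Lemma big_ord_shift (V : nmodType) (F : nat -> V) N :
  F 0%N = 0 -> F N = 0 -> \sum_(k < N) F k = \sum_(k < N) F k.+1.
Proof.
move=> F0 FN; have := erefl (\sum_(k < N.+1) F k).
by rewrite {1}big_ord_recr big_ord_recl /= F0 FN addr0 add0r.
Qed.

(** * The sub-Laplacian, coefficient by coefficient *)

Section Heisenberg.
Variables (C : fieldType) (n : nat).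
Local Notation PZ := {mpoly C[n + n]}.
Local Notation PH := {mpoly C[(n + n).+1]}.
Local Notation widen := (widen_ord (leqnSn (n + n))).
Local Notation r2 := (r2 C n).
Implicit Types (q : PZ) (p : PH).

(** The mixed terms add up because d_x and d_t commute and d_x y = d_t y = 0. *)
Lemma fieldX2 j p : fieldX j (fieldX j p) =
  p^`M(hx j)^`M(hx j) + 4%:R *: ('X_(hy j) * p^`M(hx j)^`M(ht n))
  + 4%:R *: ('X_(hy j) ^+ 2 * p^`M(ht n)^`M(ht n)).
Proof.
have yx : (hx j == hy j) = false by rewrite -val_eqE /=; have := ltn_ord j; lia.
have yt : (ht n == hy j) = false by rewrite -val_eqE /=; have := ltn_ord j; lia.
rewrite /fieldX !(mderivD, mderivZ, mderivM, mderivXU) yx yt /=.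
rewrite [p^`M(ht n)^`M(hx j)]mderiv_comm -!mul_mpolyC !rmorph_nat.
ring.
Qed.

Lemma fieldY2 j p : fieldY j (fieldY j p) =
  p^`M(hy j)^`M(hy j) - 4%:R *: ('X_(hx j) * p^`M(hy j)^`M(ht n))
  + 4%:R *: ('X_(hx j) ^+ 2 * p^`M(ht n)^`M(ht n)).
Proof.
have xy : (hy j == hx j) = false by rewrite -val_eqE /=; have := ltn_ord j; lia.
have xt : (ht n == hx j) = false by rewrite -val_eqE /=; have := ltn_ord j; lia.
rewrite /fieldY !(mderivB, mderivZ, mderivM, mderivXU) xy xt /=.
rewrite [p^`M(ht n)^`M(hy j)]mderiv_comm -!mul_mpolyC !rmorph_nat.
ring.
Qed.

Lemma mderiv_tmonom_z k (i : 'I_(n + n)) q :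
  ('X_(ht n) ^+ k * mwiden q)^`M(widen i) = 'X_(ht n) ^+ k * mwiden q^`M(i).
Proof.
rewrite mderivM mderivXUn mderiv_mwiden.
by rewrite -val_eqE /= ltn_eqF // !mul0r add0r.
Qed.

Lemma mderiv_tmonom_t k q :
  ('X_(ht n) ^+ k * mwiden q)^`M(ht n) =
    k%:R *: ('X_(ht n) ^+ k.-1 * mwiden q).
Proof.
by rewrite mderivM mderivXUn mderiv_mwiden_max mulr0 addr0 eqxx mul1r scaler_nat
  -mulrA mulr_natl.
Qed.

Lemma fieldXY_tmonom j k q (p := 'X_(ht n) ^+ k * mwiden q) :
  fieldX j (fieldX j p) + fieldY j (fieldY j p) =
    'X_(ht n) ^+ k * mwiden (q^`M(zx j)^`M(zx j) + q^`M(zy j)^`M(zy j))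
    + (4%:R * k%:R) *: ('X_(ht n) ^+ k.-1 *
        mwiden ('X_(zy j) * q^`M(zx j) - 'X_(zx j) * q^`M(zy j)))
    + (4%:R * k%:R * k.-1%:R) *: ('X_(ht n) ^+ k.-2 *
        mwiden (('X_(zx j) ^+ 2 + 'X_(zy j) ^+ 2) * q)).
Proof.
rewrite /p fieldX2 fieldY2 /hx /hy.
rewrite !(mderiv_tmonom_z, mderiv_tmonom_t, mderivZ).
rewrite !expr2 !(mwidenM, mwidenD, mwidenN) !mwidenXU.
rewrite -!mul_mpolyC !rmorphM /= !rmorph_nat.
ring.
Qed.

Lemma subLaplacian_tmonom k q :
  subLaplacian ('X_(ht n) ^+ k * mwiden q) =
    'X_(ht n) ^+ k * mwiden (Laplacian q)
    + (4%:R * k%:R) *: ('X_(ht n) ^+ k.-1 * mwiden (rotation q))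
    + (4%:R * k%:R * k.-1%:R) *: ('X_(ht n) ^+ k.-2 * mwiden (r2 * q)).
Proof.
rewrite /subLaplacian; under eq_bigr do rewrite fieldXY_tmonom.
rewrite !big_split /= -!scaler_sumr -!mulr_sumr.
by rewrite -!(raddf_sum (@mwiden (n + n) C)) -mulr_suml.
Qed.

(** The terms of u_k in degrees k - 1 and k - 2 are shifted so that each power
of t collects u_k, u_(k+1) and u_(k+2); together the last two make up - b_k. *)
Lemma subLaplacian_tsum K (u : nat -> PZ) : (forall k, (K <= k)%N -> u k = 0) ->
  subLaplacian (tsum K u) =
    tsum K (fun k => Laplacian (u k) - bterm k (u k.+1) (u k.+2)).
Proof.
move=> u0; rewrite /tsum linear_sum.
under eq_bigr do rewrite /= subLaplacian_tmonom.
rewrite !big_split /=.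
pose A k := (4%:R * k%:R) *: ('X_(ht n) ^+ k.-1 * mwiden (rotation (u k))).
pose B k := (4%:R * k%:R * k.-1%:R) *:
  ('X_(ht n) ^+ k.-2 * mwiden (r2 * u k)).
have A0 : A 0%N = 0 by rewrite /A mulr0 scale0r.
have AK : A K = 0 by rewrite /A u0 // linear0 mwiden0 mulr0 scaler0.
have B0 : B 0%N = 0 by rewrite /B mulr0 scale0r.
have B1 : B 1%N = 0 by rewrite /B mulr0 scale0r.
have BK k : (K <= k)%N -> B k = 0.
  by move=> Kk; rewrite /B u0 // mulr0 mwiden0 mulr0 scaler0.
rewrite (big_ord_shift A0 AK) (big_ord_shift B0 (BK K (leqnn K))).
rewrite (big_ord_shift (F := fun k => B k.+1) B1 (BK _ (leqnSn K))).
rewrite -!big_split; apply: eq_bigr => k _ /=.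
rewrite /A /B /= !scalerAr -!mwidenZ -!mulrDr -!mwidenD.
by rewrite /bterm !scaleNr opprB opprK -addrA [X in _ + X]addrC.
Qed.

(** A homogeneous polynomial of weight m has a coefficient of t^k of ordinary
degree m - 2 k, and this is why k stops at m./2. *)
Lemma weightE (m : 'X_{1..(n + n).+1}) :
  @weight n m = (mdeg (mnmtrunc m) + 2 * m ord_max)%N.
Proof.
rewrite /weight big_ord_recr /= eqxx mdegE; congr (_ + _)%N.
by apply: eq_bigr => i _; rewrite mnmE -val_eqE /= ltn_eqF ?mul1n.
Qed.

Lemma whomog_mwiden d q :
  q \is d.-homog -> mwiden q \is d.-homog for (@weight n).
Proof.
move=> hq; rewrite [q]mpolyE raddf_sum big_seq; apply: rpred_sum => m mq.
rewrite /= mwidenZ mwidenX; apply: rpredZ; rewrite dhomogX /= weightE.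
rewrite mnmwiden_ordmax addn0 -(dhomog_mf hq mq) /=; apply/eqP; congr mdeg.
by apply/mnmP => i; rewrite mnmE mnmwiden_widen.
Qed.

Lemma whomog_tmonom k d q : q \is d.-homog ->
  'X_(ht n) ^+ k * mwiden q \is (2 * k + d).-homog for (@weight n).
Proof.
move=> hq; apply: dhomogM (whomog_mwiden hq); apply: dhomogMn.
rewrite dhomogX /= weightE mnm1E eqxx (_ : mnmtrunc _ = 0%MM) ?mdeg0 //.
by apply/mnmP => i; rewrite mnmE mnm1E mnm0E -val_eqE /= gtn_eqF.
Qed.

Lemma whomog_coef_muni m p k : p \is m.-homog for (@weight n) ->
  (muni p)`_k \is (m - 2 * k).-homog.
Proof.
move=> hp; rewrite coef_muni big_seq_cond.
apply: rpred_sum => a /andP[ap /eqP ak].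
apply: rpredZ; rewrite dhomogX /= -(dhomog_mf hp ap) /= weightE ak.
by rewrite addnK.
Qed.

Lemma whomog_degt m p : p \is m.-homog for (@weight n) ->
  {in msupp p, forall a : 'X_{1..(n + n).+1}, (a ord_max < m./2.+1)%N}.
Proof. by move=> hp a ap; rewrite -(dhomog_mf hp ap) /= weightE; lia. Qed.

Lemma whomog_coef_muni0 m p k : p \is m.-homog for (@weight n) ->
  (m./2 < k)%N -> (muni p)`_k = 0.
Proof.
move=> hp mk; rewrite coef_muni big_seq_cond big1 // => a /andP[ap /eqP ak].
by have := whomog_degt hp ap; rewrite ak ltnS leqNgt mk.
Qed.

End Heisenberg.

(** * The downward recursion *)

(** The step uses the two following indices, as the recursion defining the
coefficients does; above [M] everything vanishes. *)
Lemma downward_ind (P : nat -> Prop) M :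
  (forall k, (M < k)%N -> P k) ->
  (forall k, (k <= M)%N -> P k.+1 -> P k.+2 -> P k) -> forall k, P k.
Proof.
move=> P_gt P_le k; suff: forall i k, (M < k + i)%N -> P k.
  by move/(_ M.+1 k); apply; lia.
elim=> [|i IHi] {}k lt; first by apply: P_gt; rewrite addn0 in lt.
have [kM|/P_gt//] := leqP k M.
by apply: P_le => //; apply: IHi; lia.
Qed.

Section Recursion.
Variables (C : fieldType) (n m : nat).
Local Notation PZ := {mpoly C[n + n]}.
Local Notation M := m./2.
Implicit Types (u v : nat -> PZ) (q : PZ).

(** What having weight [m] means for the coefficients of the powers of t. *)
Definition graded u := forall k,
  u k \is (m - 2 * k).-homog /\ ((M < k)%N -> u k = 0).

Lemma bterm_is_linear k a (u1 u2 w1 w2 : PZ) :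
  bterm k (a *: u1 + w1) (a *: u2 + w2) = a *: bterm k u1 u2 + bterm k w1 w2.
Proof.
rewrite /bterm linearP [r2 C n * (_ + _)]mulrDr -!scalerAr /=.
by rewrite -!mul_mpolyC rmorphN /=; ring.
Qed.

Lemma bterm0 k : bterm k 0 0 = 0 :> PZ.
Proof. by rewrite /bterm linear0 mulr0 !scaler0 subrr. Qed.

Lemma dhomog_bterm k d (u1 u2 : PZ) :
  u1 \is d.-homog -> r2 C n * u2 \is d.-homog -> bterm k u1 u2 \is d.-homog.
Proof.
by move=> h1 h2; apply: rpredB; apply: rpredZ => //; apply: dhomog_rotation.
Qed.

(** A particular solution of Delta_z u_k = b_k. *)
Definition correction u k : PZ :=
  Gop (m - 2 * k - 2)%N (bterm k (u k.+1) (u k.+2)).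

(** The recursion holds at the top index as well, where b_k = 0. *)
Lemma useqE v k : (k <= M)%N -> useq m v k = v k + correction (useq m v) k.
Proof.
rewrite leq_eqVlt => /predU1P[->|]; last exact: useq_rec.
by rewrite /correction useq_top !useq_gt // bterm0 linear0 addr0.
Qed.

(** The truncated degrees m - 2 k agree with the true ones only up to m./2;
for larger k the polynomial u_(k+2) vanishes. *)
Lemma dhomog_bterm_next u k :
  u k.+1 \is (m - 2 * k.+1).-homog -> u k.+2 \is (m - 2 * k.+2).-homog ->
  ((M < k.+2)%N -> u k.+2 = 0) ->
  bterm k (u k.+1) (u k.+2) \is (m - 2 * k - 2).-homog.
Proof.
move=> h1 h2 u2; have -> : (m - 2 * k - 2 = m - 2 * k.+1)%N by lia.
apply: dhomog_bterm => //; have [kM|/u2 ->] := leqP k.+2 M.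
  have -> : (m - 2 * k.+1 = 2 + (m - 2 * k.+2))%N by lia.
  exact: dhomogM (dhomog_r2 C n) h2.
by rewrite mulr0 dhomog0.
Qed.

Lemma dhomog_correction u k : (k <= M)%N ->
  u k.+1 \is (m - 2 * k.+1).-homog -> u k.+2 \is (m - 2 * k.+2).-homog ->
  (forall j, (M < j)%N -> u j = 0) -> correction u k \is (m - 2 * k).-homog.
Proof.
rewrite leq_eqVlt => /predU1P[->|kM] h1 h2 u_gt.
  by rewrite /correction !u_gt // bterm0 linear0 dhomog0.
have -> : (m - 2 * k = (m - 2 * k - 2).+2)%N by lia.
exact/dhomog_Gop/dhomog_bterm_next/u_gt.
Qed.

Lemma graded_useq v : (forall k, (k <= M)%N -> v k \is (m - 2 * k).-homog) ->
  graded (useq m v).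
Proof.
move=> hv; suff h k : useq m v k \is (m - 2 * k).-homog.
  by move=> k; split=> // /useq_gt.
move: k; apply: (downward_ind (M := M)) => [k kM|k kM h1 h2].
  by rewrite useq_gt ?dhomog0.
rewrite useqE //; apply: rpredD; first exact: hv.
by apply: dhomog_correction => // j /useq_gt.
Qed.

(** The hypothesis is pointwise, since the sequences read off from a direct sum
are equal only pointwise. *)
Lemma useq_linear a v w x k : (forall i, x i = a *: v i + w i) ->
  useq m x k = a *: useq m v k + useq m w k.
Proof.
move=> xE; move: k; apply: (downward_ind (M := M)) => [k kM|k kM h1 h2].
  by rewrite !useq_gt // scaler0 addr0.
rewrite !useqE // xE /correction h1 h2 bterm_is_linear linearP scalerDr /=.
by rewrite addrACA.
Qed.

(** The surjectivity of v |-> h, on the level of sequences: at each index the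
residual restores exactly the correction that was removed. *)
Lemma useq_residual u v : (forall k, (M < k)%N -> u k = 0) ->
  (forall k, (k <= M)%N -> v k = u k - correction u k) ->
  forall k, useq m v k = u k.
Proof.
move=> u_gt vE; apply: (downward_ind (M := M)) => [k kM|k kM h1 h2].
  by rewrite useq_gt ?u_gt.
by rewrite useqE // vE // /correction h1 h2 subrK.
Qed.

Hypotheses (charC : [pchar C] =i pred0) (n_gt0 : (0 < n)%N).

Lemma Laplacian_correction u k : graded u ->
  Laplacian (correction u k) = bterm k (u k.+1) (u k.+2).
Proof.
move=> hu; apply: Laplacian_GopK => //.
by apply: dhomog_bterm_next; apply hu.
Qed.

Lemma tsum_in_Hpred u : graded u ->
  (forall k, (k <= M)%N -> Laplacian (u k) = bterm k (u k.+1) (u k.+2)) ->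
  tsum M.+1 u \in Hpred m.
Proof.
move=> hu Lu; apply/andP; split.
  apply: rpred_sum => k _.
  have := whomog_tmonom k (hu k).1.
  by rewrite (_ : (2 * k + (m - 2 * k) = m)%N) //; have := ltn_ord k; lia.
rewrite subLaplacian_tsum => [|k /(hu k).2//].
by apply/eqP/big1 => k _; rewrite Lu -1?ltnS // subrr mwiden0 mulr0.
Qed.

(** Comparing the coefficients of t^k in the vanishing sub-Laplacian. *)
Lemma Hpred_tsum h : h \in Hpred m -> exists2 u, h = tsum M.+1 u &
  graded u /\
  forall k, (k <= M)%N -> Laplacian (u k) = bterm k (u k.+1) (u k.+2).
Proof.
move=> /andP[hh /eqP Lh]; pose u k := (muni h)`_k; have hE : h = tsum M.+1 u.
  by rewrite /u tsum_muni //; apply: whomog_degt.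
have hu : graded u.
  by move=> k; split; [apply: whomog_coef_muni|apply: whomog_coef_muni0].
exists u => //; split=> // k kM; apply/eqP; rewrite -subr_eq0; apply/eqP.
rewrite hE subLaplacian_tsum in Lh; last by move=> j /(hu j).2.
apply: (@tsum_inj _ _ M.+1
  (fun k => Laplacian (u k) - bterm k (u k.+1) (u k.+2)) (fun=> 0)) => //.
by rewrite Lh /tsum big1 // => j _; rewrite mwiden0 mulr0.
Qed.

(** * The isomorphism *)

Implicit Types x y : Ysum C n m.

(** For i > M this is a default value, which the recursion never reads. *)
Definition seqY x (i : nat) : PZ := x (inord i).

Lemma hpolyE x : hpoly x = tsum M.+1 (useq m (seqY x)).
Proof. by []. Qed.

Lemma seqY_Ypred x k : (k <= M)%N -> seqY x k \in Ypred (m - 2 * k).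
Proof.
by move=> kM; rewrite /seqY; case: (x (inord k)) => q; rewrite inordK.
Qed.

Lemma hpoly_in_Hpred x : hpoly x \in Hpred m.
Proof.
have Yx k (kM : (k <= M)%N) := andP (seqY_Ypred x kM).
have hu : graded (useq m (seqY x)) by apply: graded_useq => k /Yx[].
apply: tsum_in_Hpred => // k kM.
rewrite useqE // linearD /= Laplacian_correction //.
by case/Yx: (kM) => _ /eqP->; rewrite add0r.
Qed.

(** The polynomial determines the u_k, and v_k is u_k minus a term built from
u_(k+1) and u_(k+2). *)
Lemma hpoly_inj : injective (@hpoly C n m).
Proof.
move=> x y xy; have uE k : useq m (seqY x) k = useq m (seqY y) k.
  have [kM|kM] := leqP k M; last by rewrite !useq_gt.
  exact: tsum_inj xy _ _.
apply/ffunP => k; apply/val_inj.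
have kM : (k <= M)%N by rewrite -ltnS.
have := uE k; rewrite !useqE // /correction !uE => /addIr.
by rewrite /seqY inord_val.
Qed.

(** The residuals are harmonic because the correction has Laplacian b_k. *)
Lemma hpoly_surj h : h \in Hpred m -> exists x, hpoly x = h.
Proof.
move=> /Hpred_tsum[u -> [hu Lu]].
have Yv (k : 'I_M.+1) : u k - correction u k \in Ypred (m - 2 * k).
  have kM : (k <= M)%N by rewrite -ltnS.
  apply/andP; split; last first.
    by rewrite linearB /= Laplacian_correction // Lu // subrr.
  apply: rpredB; first exact: (hu k).1.
  by apply: dhomog_correction => // [||j]; apply hu.
exists [ffun k : 'I_M.+1 => MkY (Yv k)]; rewrite hpolyE.
apply: eq_bigr => k _; congr (_ * mwiden _).
apply: useq_residual => [j /(hu j).2//|j jM].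
by rewrite /seqY ffunE /= inordK.
Qed.

Definition hmap x : Hspace C n m := MkH (hpoly_in_Hpred x).

Lemma hmap_is_linear : linear hmap.
Proof.
move=> a x y; apply: val_inj => /=.
rewrite !hpolyE /tsum scaler_sumr -big_split; apply: eq_bigr => k _ /=.
rewrite scalerAr -mulrDr -mwidenZ -mwidenD.
rewrite -(@useq_linear a _ _ (seqY (a *: x + y))) //.
by move=> i; rewrite /seqY !ffunE.
Qed.
HB.instance Definition _ := GRing.isLinear.Build C _ _ _ hmap hmap_is_linear.

Lemma hmap_bij : bijective hmap.
Proof.
have surj h : exists x, hmap x == h.
  by have [x xh] := hpoly_surj (valP h); exists x; apply/eqP/val_inj.
exists (fun h => xchoose (surj h)) => [x|h]; last exact/eqP/(xchooseP (surj h)).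
by apply/hpoly_inj/(congr1 val (eqP (xchooseP (surj (hmap x))))).
Qed.

End Recursion.

Theorem theoremA3 (R : realType) (n m : nat) (hn : (1 <= n)%N) :
  [/\ forall v : Ysum R[i] n m, hpoly v \in Hpred m,
      forall h : {mpoly R[i][(n + n).+1]}, h \in Hpred m ->
        exists! v : Ysum R[i] n m, hpoly v = h
    & exists f : {linear Ysum R[i] n m -> Hspace R[i] n m},
        bijective f /\ forall v, Hval (f v) = hpoly v].
Proof.
have charC : [pchar R[i]] =i pred0 := @Num.Theory.pchar_num _.
split=> [v|h /(hpoly_surj charC hn)[v vh]|]; first exact: hpoly_in_Hpred.
  by exists v; split=> // w wh; apply: hpoly_inj; rewrite vh wh.
by exists (hmap charC hn); split=> //; apply: hmap_bij.
Qed.
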